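(* Let $X$ be a normed linear space over $\mathbb{C}$. Then the weak nonstandard hull $\widehat{X}$ of $X$, with its norm, is a Banach space isometrically isomorphic to the bidual $X''$ of $X$.
   Context: Nonstandard setting: a fixed nonstandard extension $Y\mapsto{}^*Y$ of the standard mathematical universe satisfying the Transfer Principle and $\kappa$-saturation: every family of at most $\kappa$ internal sets with the finite intersection property has nonempty intersection. Here $\kappa$ is a sufficiently large uncountable cardinal (in particular greater than the cardinality of $X'$). For $r,s$ in ${}^*\mathbb{R}$ or ${}^*\mathbb{C}$, $r\approx s$ means $|r-s|<1/n$ for all $n\in\mathbb{N}$; if $r$ is finite (i.e. $|r|<n$ for some $n\in\mathbb{N}$), ${}^\circ r$ is its standard part; for infinite $r\ge0$ put ${}^\circ r=\infty$. $X'$ is the dual of $X$ (bounded linear forms) and $X''$ the bidual. Weak nonstandard hull: $\mathrm{Fin}({}^*X):=\{x\in{}^*X:\sup_{\phi\in X',\|\phi\|\le1}{}^\circ|{}^*\phi(x)|<\infty\}$; $\mathfrak I:=\{x\in\mathrm{Fin}({}^*X):{}^*\phi(x)\approx0\text{ for all }\phi\in X'\}$; $\widehat X:=\mathrm{Fin}({}^*X)/\mathfrak I$ as a complex linear space, with $\widehat x:=x+\mathfrak I$ and $\|\widehat x\|:=\sup\{{}^\circ|{}^*\phi(x)|:\phi\in X',\|\phi\|\le1\}$. *)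

(* Defs.v *)
From HB Require Import structures.
From mathcomp Require Import all_boot all_order all_algebra generic_quotient.
From mathcomp Require Import complex.
From mathcomp Require Import all_classical all_reals.
From mathcomp Require Import ereal topology normedtype.
From mathcomp Require Import lra.
Set Implicit Arguments.
Unset Strict Implicit.
Unset Printing Implicit Defensive.
Import Order.TTheory GRing.Theory Num.Theory.
Import numFieldNormedType.Exports.
Local Open Scope classical_set_scope.
Local Open Scope card_scope.
Local Open Scope ring_scope.
Local Open Scope complex_scope.
Local Open Scope quotient_scope.

(* The first-order language of the mathematical universe.  Types play the role
   of the sets of the universe: the sorts are all the types [A : Type] (hence
   also [set A], [A -> B], [A * B]...), every object of every type is a
   constant, and the only operation is the application of a function to an
   argument.  Membership of [x] in [P : set A] is the equation [P x = True], and
   a quantifier bounded by [P] is a quantifier over [A] relativized to [P]. *)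

Inductive var : seq Type -> Type -> Type :=
| V0 G A : var (A :: G) A
| VS G A B : var G A -> var (B :: G) A.

Inductive term (G : seq Type) : Type -> Type :=
| Var A of var G A : term G A
| Cst A of A : term G A
| App A B of term G (A -> B) & term G A : term G B.

Inductive formula : seq Type -> Type :=
| FEq G A of term G A & term G A : formula G
| FNot G of formula G : formula G
| FAnd G of formula G & formula G : formula G
| FOr G of formula G & formula G : formula G
| FImp G of formula G & formula G : formula G
| FAll G A of formula (A :: G) : formula G
| FEx G A of formula (A :: G) : formula G.

Record frame := Frame {
  dom : Type -> Type;
  std : forall A : Type, A -> dom A;
  ap : forall A B : Type, dom (A -> B) -> dom A -> dom B }.
Arguments std F {A} : rename.
Arguments ap {F A B} : rename.

Definition standard_frame : frame :=
  @Frame (fun A => A) (fun A a => a) (fun A B f a => f a).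

Fixpoint env (F : frame) (G : seq Type) : Type :=
  if G is A :: G' then (dom F A * env F G')%type else unit.

Fixpoint lookup (F : frame) G A (v : var G A) : env F G -> dom F A :=
  match v with
  | V0 _ _ => fun e => e.1
  | VS _ _ _ v' => fun e => lookup v' e.2
  end.

Fixpoint eval (F : frame) G A (t : term G A) (e : env F G) : dom F A :=
  match t with
  | Var _ v => lookup v e
  | Cst _ a => std F a
  | App _ _ t1 t2 => ap (eval t1 e) (eval t2 e)
  end.

Fixpoint sat (F : frame) G (f : formula G) : env F G -> Prop :=
  match f with
  | FEq _ _ t u => fun e => eval t e = eval u e
  | FNot _ g => fun e => ~ sat g e
  | FAnd _ g h => fun e => sat g e /\ sat h e
  | FOr _ g h => fun e => sat g e \/ sat h e
  | FImp _ g h => fun e => sat g e -> sat h e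
  | FAll _ A g => fun e => forall a : dom F A, sat g (a, e)
  | FEx _ A g => fun e => exists a : dom F A, sat g (a, e)
  end.

(* [dom N A] is *A, and [std N a] is *a. *)
Record nonstandard_extension := NonstandardExtension {
  ns_frame :> frame;
  transfer : forall f : formula [::],
    @sat standard_frame [::] f tt <-> @sat ns_frame [::] f tt }.

Section Nonstandard.
Variable N : nonstandard_extension.

Definition lift1 (A B : Type) (f : A -> B) (x : dom N A) : dom N B :=
  ap (std N f) x.

Definition lift2 (A B C : Type) (f : A -> B -> C) (x : dom N A) (y : dom N B) :
  dom N C := ap (ap (std N f) x) y.

Definition holds (p : dom N Prop) : Prop := p = std N True.

(* An internal subset of *A is the extension of an element of *(set A). *)
Definition internal (A : Type) (S : set (dom N A)) : Prop :=
  exists s : dom N (A -> Prop), S = [set x | holds (ap s x)].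

Definition saturated (K : Type) : Prop :=
  forall (A : Type) (F : set (set (dom N A))),
    (forall S, F S -> internal S) ->
    F #<= [set: K] ->
    (forall G : set (set (dom N A)), finite_set G -> G `<=` F ->
       \bigcap_(S in G) S !=set0) ->
    \bigcap_(S in F) S !=set0.

(* [ns_lt], [ns_approx] and [ns_finite] serve both for *R and, the norm and the
   order being those of a numFieldType, for *C. *)
Definition ns_lt (K : numFieldType) (r s : dom N K) : Prop :=
  holds (lift2 (fun a b : K => (a < b : Prop)) r s).

Definition ns_approx (K : numFieldType) (r s : dom N K) : Prop :=
  forall n : nat, ns_lt (lift2 (fun a b : K => `|a - b|) r s)
                        (std N (n.+1%:R^-1 : K)).

Definition ns_finite (K : numFieldType) (r : dom N K) : Prop :=
  exists n : nat, ns_lt (lift1 (fun a : K => `|a|) r) (std N (n%:R : K)).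

(* The standard part, for [r >= 0]; for finite [r], [xget] picks the unique real
   number infinitely close to [r]. *)
Definition st (R : realType) (r : dom N R) : \bar R :=
  if `[< ns_finite r >]
  then (xget 0 [set s : R | ns_approx r (std N s)])%:E else +oo%E.

End Nonstandard.
Arguments holds {N}.

Section Dual.
Variables (R : realType) (X : normedModType R[i]).

Definition bounded_form : {pred X -> R[i]^o} := fun f : X -> R[i] =>
  `[< scalar f /\ exists M : R[i], forall x, `|f x| <= M * `|x| >].

Lemma bounded_form_submod : submod_closed bounded_form.
Proof.
split=> [|a f g /asboolP[fl [M fM]] /asboolP[gl [L gL]]]; apply/asboolP.
  split; first by move=> b x y /=; rewrite mulr0 addr0.
  by exists 0 => x /=; rewrite normr0 mul0r.
split=> [b x y /=|].
  change (a * f (b *: x + y) + g (b *: x + y) =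
          b * (a * f x + g x) + (a * f y + g y)).
  by rewrite fl gl !mulrDr addrACA mulrCA.
exists (`|a| * M + L) => x; rewrite mulrDl -mulrA.
rewrite (le_trans (ler_normD _ _))// lerD// normrM.
by rewrite ler_wpM2l.
Qed.

HB.instance Definition _ :=
  GRing.isSubmodClosed.Build R[i] (X -> R[i]^o) bounded_form
    bounded_form_submod.

Record dual := Dual { dual_fun :> X -> R[i]^o; _ : dual_fun \in bounded_form }.

HB.instance Definition _ := [isSub for dual_fun].
HB.instance Definition _ := [Choice of dual by <:].
HB.instance Definition _ := [SubChoice_isSubLmodule of dual by <:].

Definition dual_norm (f : dual) : R :=
  sup [set Normc.normc (f x) | x in [set x : X | `|x| <= 1]].

Lemma dualP (f : dual) :
  scalar (f : X -> R[i]) /\ exists M : R[i], forall x, `|f x| <= M * `|x|.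
Proof. by case: f => f /= /asboolP. Qed.

Lemma dualE (f : dual) (a : R[i]) x y : f (a *: x + y) = a * f x + f y.
Proof. by have [+ _] := dualP f; exact. Qed.

Lemma dual0 (f : dual) : f 0 = 0.
Proof.
have := dualE f 1 0 0; rewrite scale1r mul1r addr0 => /esym/eqP.
by rewrite -subr_eq0 addrK => /eqP.
Qed.

Lemma dualZ (f : dual) (a : R[i]) x : f (a *: x) = a * f x.
Proof. by rewrite -[a *: x]addr0 dualE dual0 addr0. Qed.

Lemma dualD (f : dual) x y : f (x + y) = f x + f y.
Proof. by rewrite -[x in LHS]scale1r dualE mul1r. Qed.

Lemma normcC (z : R[i]) : `|z| = (Normc.normc z)%:C.
Proof. by []. Qed.

Lemma dual_norm_ub (f : dual) x : `|x| <= 1 -> Normc.normc (f x) <= dual_norm f.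
Proof.
move=> x1; apply: sup_upper_bound; last by exists x.
split; first by exists (Normc.normc (f x)), x.
have [_ [M fM]] := dualP f; exists (Normc.normc M) => _ [y /= y1 <-].
rewrite -lecR -!normcC.
have fy := fM y; rewrite (le_trans fy)//.
have -> : M * `|y| = `|M| * `|y|.
  by rewrite -[LHS]ger0_norm ?(le_trans _ fy)// normrM normr_id.
by rewrite -[leRHS]mulr1 ler_wpM2l.
Qed.

Lemma dual_norm_le (f : dual) (m : R) :
  (forall x, `|x| <= 1 -> Normc.normc (f x) <= m) -> dual_norm f <= m.
Proof.
move=> fm; apply: ge_sup; last by move=> _ [x /= x1 <-]; exact: fm.
by exists (Normc.normc (f 0)), 0 => //=; rewrite normr0.
Qed.

Lemma dual_norm_ge0 (f : dual) : 0 <= dual_norm f.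
Proof.
have := @dual_norm_ub f 0; rewrite normr0 dual0 => /(_ ler01).
by rewrite Normc.normc0.
Qed.

Lemma dual_normD (f g : dual) :
  (dual_norm (f + g))%:C <= (dual_norm f)%:C + (dual_norm g)%:C.
Proof.
rewrite -rmorphD/= lecR; apply: dual_norm_le => x x1.
rewrite (le_trans (le_normcD _ _))//.
by apply: lerD; exact: dual_norm_ub.
Qed.

Lemma dual_normZ_le (a : R[i]) (f : dual) :
  dual_norm (a *: f) <= Normc.normc a * dual_norm f.
Proof.
apply: dual_norm_le => x x1.
change (Normc.normc (a * f x) <= Normc.normc a * dual_norm f).
rewrite Normc.normcM ler_wpM2l ?dual_norm_ub//.
by rewrite -lecR -[X in _ <= X]normcC (normr_ge0 a).
Qed.

Lemma dual_normZ (a : R[i]) (f : dual) :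
  (dual_norm (a *: f))%:C = `|a| * (dual_norm f)%:C.
Proof.
rewrite normcC -rmorphM/=; congr (_%:C); apply/le_anti.
rewrite dual_normZ_le /=.
have [->|a0] := eqVneq a 0.
  by rewrite Normc.normc0 mul0r dual_norm_ge0.
have na : 0 < Normc.normc a by rewrite -ltcR -normcC normr_gt0.
rewrite -ler_pdivlMl// -Normc.normcV.
have fE : f = a^-1 *: (a *: f) by rewrite scalerA mulVf// scale1r.
by rewrite {1}fE; exact: dual_normZ_le.
Qed.

Lemma dual_norm0_eq0 (f : dual) : (dual_norm f)%:C = 0 -> f = 0.
Proof.
move=> [f0]; apply/val_inj/funext => x /=.
change (f x = 0).
have [->|x0] := eqVneq x 0; first exact: dual0.
have nx : `|x| != 0 by rewrite normr_eq0.
have -> : x = `|x| *: (`|x|^-1 *: x) by rewrite scalerA mulfV// scale1r.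
rewrite dualZ; apply/eqP; rewrite mulf_eq0 (negbTE nx) /=.
rewrite -normr_eq0 eq_le normr_ge0 andbT normcC.
rewrite -[leRHS]/((0 : R)%:C) lecR -f0 dual_norm_ub//.
by rewrite normrZ normfV normr_id mulVf.
Qed.

(* The norm of a normed module over R[i] takes its values in R[i]. *)
HB.instance Definition _ := Lmodule_isNormed.Build R[i] dual
  dual_normD dual_normZ dual_norm0_eq0.

End Dual.

Arguments V0 {G A}.
Arguments VS {G A B}.
Arguments Cst {G A}.

Section TransferLemmas.
Variable N : nonstandard_extension.

Let A1 G A B (f : A -> B) (t : term G A) := App (Cst f) t.
Let A2 G A B C (f : A -> B -> C) (t : term G A) (u : term G B) :=
  App (A1 f t) u.
Let x0 G A : term (A :: G) A := Var V0.
Let x1 G A B : term (B :: A :: G) A := Var (VS V0).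
Let x2 G A B C : term (C :: B :: A :: G) A := Var (VS (VS V0)).
Let FHolds G (t : term G Prop) := FEq t (Cst True).

Lemma eq_TrueI (P : Prop) : P -> P = True. Proof. by rewrite propeqE. Qed.

Lemma lift1_std A B (f : A -> B) (a : A) : lift1 f (std N a) = std N (f a).
Proof. exact: (transfer N (FEq (A1 f (Cst a)) (Cst (f a)))).1 erefl. Qed.

Lemma transfer_assoc A (f : A -> A -> A) : associative f ->
  associative (@lift2 N _ _ _ f).
Proof.
move=> fA; have /= := (transfer N (FAll (FAll (FAll (FEq
  (A2 f (x2 _ _ _ _) (A2 f (x1 _ _ _) (x0 _ _)))
  (A2 f (A2 f (x2 _ _ _ _) (x1 _ _ _)) (x0 _ _))))))).1.
by apply => a b c; exact: fA.
Qed.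

Lemma transfer_comm A (f : A -> A -> A) : commutative f ->
  commutative (@lift2 N _ _ _ f).
Proof.
move=> fC; have /= := (transfer N (FAll (FAll (FEq
  (A2 f (x1 _ _ _) (x0 _ _)) (A2 f (x0 _ _) (x1 _ _ _)))))).1.
by apply => a b; exact: fC.
Qed.

Lemma transfer_left_id A (e : A) (f : A -> A -> A) : left_id e f ->
  left_id (std N e) (lift2 f).
Proof.
move=> fe; have /= := (transfer N (FAll (FEq
  (A2 f (Cst e) (x0 _ _)) (x0 _ _)))).1.
by apply => a; exact: fe.
Qed.

Lemma transfer_left_inverse A (e : A) (i : A -> A) (f : A -> A -> A) :
  left_inverse e i f -> left_inverse (std N e) (lift1 i) (lift2 f).
Proof.
move=> fi; have /= := (transfer N (FAll (FEq
  (A2 f (A1 i (x0 _ _)) (x0 _ _)) (Cst e)))).1.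
by apply => a; exact: fi.
Qed.

Lemma transfer_eq1 A B (f g : A -> B) : f =1 g -> lift1 f =1 @lift1 N _ _ g.
Proof. by move=> /funext ->. Qed.

Lemma lift1_comp A B C (f : B -> C) (g : A -> B) (x : dom N A) :
  lift1 f (lift1 g x) = lift1 (f \o g) x.
Proof.
have /= := (transfer N (FAll (FEq
  (A1 f (A1 g (x0 _ _))) (A1 (f \o g) (x0 _ _))))).1.
by apply => a.
Qed.

Lemma lift1_id A (x : dom N A) : lift1 id x = x.
Proof.
have /= := (transfer N (FAll (FEq (A1 (@id A) (x0 _ _)) (x0 _ _)))).1.
by apply => a.
Qed.

Lemma lift1_lift2 A B C D (f : C -> D) (g : A -> B -> C) (x : dom N A) y :
  lift1 f (lift2 g x y) = lift2 (fun a b => f (g a b)) x y.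
Proof.
have /= := (transfer N (FAll (FAll (FEq (A1 f (A2 g (x1 _ _ _) (x0 _ _)))
  (A2 (fun a b => f (g a b)) (x1 _ _ _) (x0 _ _)))))).1.
by apply => a b.
Qed.

Lemma lift2_lift1 A B C A' B' (f : A -> B -> C) (g : A' -> A) (h : B' -> B)
    (x : dom N A') (y : dom N B') :
  lift2 f (lift1 g x) (lift1 h y) = lift2 (fun a b => f (g a) (h b)) x y.
Proof.
have /= := (transfer N (FAll (FAll (FEq
  (A2 f (A1 g (x1 _ _ _)) (A1 h (x0 _ _)))
  (A2 (fun a b => f (g a) (h b)) (x1 _ _ _) (x0 _ _)))))).1.
by apply => a b.
Qed.

Lemma lift2_diag A B C D (f : B -> C -> D) (g : A -> B) (h : A -> C)
    (x : dom N A) :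
  lift2 f (lift1 g x) (lift1 h x) = lift1 (fun a => f (g a) (h a)) x.
Proof.
have /= := (transfer N (FAll (FEq (A2 f (A1 g (x0 _ _)) (A1 h (x0 _ _)))
  (A1 (fun a => f (g a) (h a)) (x0 _ _))))).1.
by apply => a.
Qed.

Lemma lift2_stdr A B C (f : A -> B -> C) (x : dom N A) (b : B) :
  lift2 f x (std N b) = lift1 (f^~ b) x.
Proof.
have /= := (transfer N (FAll (FEq (A2 f (x0 _ _) (Cst b))
  (A1 (f^~ b) (x0 _ _))))).1.
by apply => a.
Qed.

Lemma transfer_imp1 A (P Q : A -> Prop) (x : dom N A) :
  (forall a, P a -> Q a) -> holds (lift1 P x) -> holds (lift1 Q x).
Proof.
move=> PQ; have /= := (transfer N (FAll (FImp (FHolds (A1 P (x0 _ _)))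
   (FHolds (A1 Q (x0 _ _)))))).1.
apply => a Pa; apply/eq_TrueI/PQ.
by have -> : P a = True by exact: Pa.
Qed.

Lemma transfer_imp2 A (P Q S : A -> Prop) (x : dom N A) :
  (forall a, P a -> Q a -> S a) ->
  holds (lift1 P x) -> holds (lift1 Q x) -> holds (lift1 S x).
Proof.
move=> PQ; have /= := (transfer N (FAll (FImp (FHolds (A1 P (x0 _ _)))
   (FImp (FHolds (A1 Q (x0 _ _))) (FHolds (A1 S (x0 _ _))))))).1.
apply => a Pa Qa; apply/eq_TrueI/PQ.
  by have -> : P a = True by exact: Pa.
by have -> : Q a = True by exact: Qa.
Qed.

Lemma transfer_imp11 A B (P : A -> Prop) (Q : B -> Prop) (S : A -> B -> Prop)
    (x : dom N A) (y : dom N B) :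
  (forall a b, P a -> Q b -> S a b) ->
  holds (lift1 P x) -> holds (lift1 Q y) -> holds (lift2 S x y).
Proof.
move=> PQ; have /= := (transfer N (FAll (FAll (FImp (FHolds (A1 P (x1 _ _ _)))
   (FImp (FHolds (A1 Q (x0 _ _))) (FHolds (A2 S (x1 _ _ _) (x0 _ _)))))))).1.
apply => a b Pa Qb; apply/eq_TrueI/PQ.
  by have -> : P a = True by exact: Pa.
by have -> : Q b = True by exact: Qb.
Qed.

Lemma transfer_not A (P Q : A -> Prop) (x : dom N A) :
  (forall a, ~ P a -> Q a) -> ~ holds (lift1 P x) -> holds (lift1 Q x).
Proof.
move=> PQ; have /= := (transfer N (FAll (FImp (FNot (FHolds (A1 P (x0 _ _))))
   (FHolds (A1 Q (x0 _ _)))))).1.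
by apply => a Pa; apply/eq_TrueI/PQ => Pa'; apply/Pa/eq_TrueI.
Qed.

Lemma transfer_absurd A (P Q : A -> Prop) (x : dom N A) :
  (forall a, P a -> ~ Q a) -> holds (lift1 P x) -> holds (lift1 Q x) -> False.
Proof.
move=> PQ; have /= := (transfer N (FAll (FImp (FHolds (A1 P (x0 _ _)))
   (FNot (FHolds (A1 Q (x0 _ _))))))).1.
apply => a Pa Qa; apply: (PQ a).
  by have -> : P a = True by exact: Pa.
by have -> : Q a = True by exact: Qa.
Qed.

Lemma holds_all A (P : A -> Prop) (x : dom N A) :
  (forall a, P a) -> holds (lift1 P x).
Proof.
move=> PQ; have /= := (transfer N (FAll (FHolds (A1 P (x0 _ _))))).1.
by apply => a; exact/eq_TrueI/PQ.
Qed.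

Lemma ns_lt_stdr (K : numFieldType) A (f : A -> K) (x : dom N A) (s : K) :
  ns_lt (lift1 f x) (std N s) = holds (lift1 (fun a => (f a < s : Prop)) x).
Proof.
by rewrite /ns_lt lift2_stdr lift1_comp.
Qed.

Lemma ns_approx_stdr (K : numFieldType) A (f : A -> K) (x : dom N A) (s : K) :
  ns_approx (lift1 f x) (std N s) <->
  forall n, holds (lift1 (fun a => (`|f a - s| < n.+1%:R^-1 : Prop)) x).
Proof.
rewrite /ns_approx; split => + n => /(_ n);
  by rewrite lift2_stdr lift1_comp ns_lt_stdr.
Qed.

Section StandardPart.
Variable R : realType.

Lemma small_inv (e : R) : 0 < e -> exists n : nat, n.+1%:R^-1 < e.
Proof.
move=> e0; exists (Num.truncn e^-1).
by rewrite invf_plt ?posrE// Num.Theory.truncnS_gt.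
Qed.

Lemma st_exists A (f : A -> R) (x : dom N A) :
  ns_finite (lift1 f x) -> exists s : R, ns_approx (lift1 f x) (std N s).
Proof.
move=> [n]; rewrite lift1_comp ns_lt_stdr => fn.
pose D := [set q : R | holds (lift1 (fun a => (q < f a : Prop)) x)].
have DN : D (- n%:R).
  by apply: transfer_imp1 fn => a /=; rewrite ltr_norml => /andP[].
have Dn : ubound D n%:R.
  move=> q qD; rewrite leNgt; apply/negP => nq.
  apply: (transfer_absurd _ qD fn) => a /= qa.
  rewrite ltr_norml => /andP[_] /(lt_trans qa)/(lt_trans nq).
  by rewrite ltxx.
have supD : has_sup D by split; [exists (- n%:R) | exists n%:R].
exists (sup D); apply/ns_approx_stdr => m.
have m0 : 0 < m.+1%:R^-1 :> R by rewrite invr_gt0 ltr0n.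
have [q Dq qs] := sup_adherent m0 supD.
have Ns : ~ D (sup D + m.+1%:R^-1 / 2).
  move=> /(sup_upper_bound supD); rewrite gerDl leNgt.
  by rewrite divr_gt0.
apply: (transfer_imp2 (P := fun a => q < f a)
    (Q := fun a => f a <= sup D + m.+1%:R^-1 / 2)) => //.
  move=> a qa fa; rewrite ltr_distl (lt_trans qs)//=.
  by rewrite (le_lt_trans fa)// ltrD2l ltr_pdivrMr// ltr_pMr// ltr1n.
by apply: transfer_not Ns => a /=; rewrite leNgt => /negP.
Qed.

Lemma st_le A (f : A -> R) (x : dom N A) (q : R) : (forall a, 0 <= f a) ->
  (st (lift1 f x) <= q%:E)%E <->
  forall e, 0 < e -> holds (lift1 (fun a => (f a < q + e : Prop)) x).
Proof.
move=> f0; rewrite /st; split=> [|H].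
  case: asboolP => // /st_exists[s0 xs0]; rewrite lee_fin => + e e0.
  case: xgetP => [s _ /= xs sq|/(_ s0)//].
  have [n ne] := small_inv e0.
  move: xs => /ns_approx_stdr/(_ n); apply: transfer_imp1 => a.
  rewrite ltr_distl => /andP[_ /lt_le_trans]; apply.
  by rewrite lerD// ltW.
have fin : ns_finite (lift1 f x).
  exists (Num.truncn (q + 1)).+1; rewrite lift1_comp ns_lt_stdr.
  apply: transfer_imp1 (H 1 ltr01) => a /= /lt_trans.
  by rewrite ger0_norm//; apply; rewrite truncnS_gt.
rewrite asboolT// lee_fin.
have [s0 xs0] := st_exists fin.
case: xgetP => [s _ /= xs|/(_ s0)//].
rewrite leNgt; apply/negP => qs.
have e0 : 0 < (s - q) / 2 by rewrite divr_gt0// subr_gt0.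
have [n ne] := small_inv e0.
move: xs => /ns_approx_stdr/(_ n).
apply: (transfer_absurd _ (H _ e0)) => a fa.
rewrite ltr_distl => /andP[+ _]; apply/negP; rewrite -leNgt.
rewrite (le_trans (ltW fa))// lerBrDr.
rewrite (le_trans (lerD (lexx _) (ltW ne)))//.
by rewrite -addrA -splitr addrC subrK.
Qed.

Lemma st_ge0 A (f : A -> R) (x : dom N A) : (forall a, 0 <= f a) ->
  (0 <= st (lift1 f x))%E.
Proof.
move=> f0; rewrite /st.
case: asboolP => [/st_exists[s0 xs0]|_]; last by rewrite leey.
rewrite lee_fin; case: xgetP => // s _ /= /ns_approx_stdr xs.
rewrite leNgt; apply/negP => s_lt0.
have [|n ne] := @small_inv (- s); first by rewrite oppr_gt0.
apply: (transfer_absurd _ (xs n) (holds_all x f0)) => a.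
rewrite ltr_distl => /andP[_ fa] a0.
have sn : s + n.+1%:R^-1 < 0 by rewrite -ltrBrDl sub0r.
by have := lt_trans (le_lt_trans a0 fa) sn; rewrite ltxx.
Qed.

End StandardPart.
End TransferLemmas.

Section WeakHull.
Variables (N : nonstandard_extension) (R : realType) (X : normedModType R[i]).

(* *X as a linear space over C, that is, with the scalars restricted from *C to
   the standard ones. *)
Definition star_space : Type := dom N X.

HB.instance Definition _ := gen_eqMixin star_space.
HB.instance Definition _ := gen_choiceMixin star_space.

HB.instance Definition _ := GRing.isZmodule.Build star_space
  (transfer_assoc (N := N) (@addrA X)) (transfer_comm (N := N) (@addrC X))
  (transfer_left_id (N := N) (@add0r X))
  (transfer_left_inverse (N := N) (@addNr X)).

Definition star_scale (a : R[i]) (x : star_space) : star_space :=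
  lift1 (fun v : X => a *: v) x.

Lemma star_scaleA a b x : star_scale a (star_scale b x) = star_scale (a * b) x.
Proof.
by rewrite /star_scale lift1_comp; apply: transfer_eq1 => v /=; rewrite scalerA.
Qed.

Lemma star_scale1 : left_id 1 star_scale.
Proof.
move=> x; rewrite -[RHS]lift1_id; apply: transfer_eq1 => v; exact: scale1r.
Qed.

Lemma star_scaleDr : right_distributive star_scale +%R.
Proof.
move=> a x y; rewrite /star_scale /GRing.add /= lift1_lift2 lift2_lift1.
by congr (lift2 _ _ _); apply/funext => u; apply/funext => v; rewrite scalerDr.
Qed.

Lemma star_scaleDl x : {morph star_scale^~ x : a b / a + b >-> a + b}.
Proof.
move=> a b; rewrite /star_scale /GRing.add /= lift2_diag.
by apply: transfer_eq1 => v; rewrite scalerDl.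
Qed.

HB.instance Definition _ := GRing.Zmodule_isLmodule.Build R[i] star_space
  star_scaleA star_scale1 star_scaleDr star_scaleDl.

Definition weak_norm (x : star_space) : \bar R :=
  ereal_sup [set st (lift1 (@Normc.normc R) (lift1 (f : X -> R[i]) x))
            | f in [set f : dual X | `|f| <= 1]].

Definition fin_pred : {pred star_space} := fun x => `[< (weak_norm x < +oo)%E >].

Lemma normc_ge0 (z : R[i]) : 0 <= Normc.normc z.
Proof. by rewrite -lecR -[X in _ <= X]normcC (normr_ge0 z). Qed.

Lemma weak_norm_le x (q : R) : (weak_norm x <= q%:E)%E <->
  forall f : dual X, `|f| <= 1 -> forall e, 0 < e ->
    holds (lift1 (fun v => (Normc.normc (f v) < q + e : Prop)) x).
Proof.
split=> [xq f f1|H].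
  apply/(st_le x q (fun v => normc_ge0 (f v))); apply: le_trans xq.
  by apply: ereal_sup_ubound; exists f => //; rewrite lift1_comp.
apply: ge_ereal_sup => _ [f /= f1 <-]; rewrite lift1_comp.
by apply/(st_le x q (fun v => normc_ge0 (f v))); exact: H.
Qed.

Lemma weak_norm_ge0 x : (0 <= weak_norm x)%E.
Proof.
apply: (@le_trans _ _ (st (lift1 (fun v => Normc.normc ((0 : dual X) v)) x))).
  by apply: st_ge0 => v; exact: normc_ge0.
apply: ereal_sup_ubound; exists 0; first by rewrite /= normr0.
by rewrite lift1_comp.
Qed.

Lemma weak_norm_lin a x y (q r : R) :
  (weak_norm x <= q%:E -> weak_norm y <= r%:E ->
   weak_norm (a *: x + y)%R <= (Normc.normc a * q + r)%:E)%E.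
Proof.
move=> /weak_norm_le xq /weak_norm_le yr; apply/weak_norm_le => f f1 e e0.
set m := Normc.normc a.
have m1 : 0 < m + 1 by rewrite ltr_wpDl// normc_ge0.
have d0 : 0 < e / 2 / (m + 1) by rewrite !divr_gt0.
have e20 : 0 < e / 2 by rewrite divr_gt0.
have := transfer_imp11 (S := fun u v =>
  Normc.normc (f (a *: u + v)) < m * q + r + e) _ (xq f f1 _ d0) (yr f f1 _ e20).
have -> : a *: x + y = lift2 +%R (lift1 (fun v : X => a *: v) x)
                                 (lift1 id (y : dom N X)).
  by rewrite lift1_id.
rewrite lift2_lift1 lift1_lift2.
apply => u v fu fv; rewrite dualE (le_lt_trans (le_normcD _ _))//.
rewrite Normc.normcM -/m.
have h : m * Normc.normc (f u) <= m * q + e / 2.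
  rewrite (le_trans (ler_wpM2l (normc_ge0 a) (ltW fu)))// mulrDr lerD2l.
  rewrite mulrCA ger_pMr// ler_pdivrMr// mul1r lerDl ler01 //.
rewrite (le_lt_trans (lerD h (lexx _)))//.
by move: fv; lra.
Qed.

Lemma weak_norm0 : weak_norm 0 = 0%E.
Proof.
apply/le_anti; rewrite weak_norm_ge0 andbT; apply/weak_norm_le => f f1 e e0.
rewrite /GRing.zero /= lift1_std; congr std; apply: propT.
by rewrite dual0 Normc.normc0 add0r.
Qed.

Lemma fin_predP x : reflect (exists q : R, weak_norm x <= q%:E)%E (x \in fin_pred).
Proof.
apply: (iffP (asboolP _)) => [xoo|[q /le_lt_trans]]; last by apply; exact: ltry.
exists (fine (weak_norm x)); rewrite fineK//.
by rewrite ge0_fin_numE// weak_norm_ge0.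
Qed.

Lemma fin_submod : submod_closed fin_pred.
Proof.
split=> [|a x y /fin_predP[q xq] /fin_predP[r yr]]; apply/fin_predP.
  by exists 0; rewrite weak_norm0.
by exists (Normc.normc a * q + r); exact: weak_norm_lin.
Qed.

HB.instance Definition _ :=
  GRing.isSubmodClosed.Build R[i] star_space fin_pred fin_submod.

Record fin_part := FinPart { fin_val :> star_space; _ : fin_val \in fin_pred }.

HB.instance Definition _ := [isSub for fin_val].
HB.instance Definition _ := [Choice of fin_part by <:].
HB.instance Definition _ := [SubChoice_isSubLmodule of fin_part by <:].

Definition infinitesimal : {pred fin_part} := fun x =>
  `[< forall f : dual X,
        ns_approx (lift1 (f : X -> R[i]) (x : star_space)) (std N (0 : R[i])) >].

Lemma infinitesimalP (x : fin_part) :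
  x \in infinitesimal <-> (weak_norm x <= 0%:E)%E.
Proof.
split=> [/asboolP xI|/weak_norm_le xI].
  apply/weak_norm_le => f f1 e e0; have [n ne] := small_inv e0.
  have /ns_approx_stdr/(_ n) := xI f; apply: transfer_imp1 => v.
  rewrite subr0 normcC add0r => h; apply: lt_trans ne.
  by rewrite -ltcR fmorphV rmorph_nat.
apply/asboolP => f; apply/ns_approx_stdr => n.
set c := dual_norm f + 1.
have c0 : 0 < c by rewrite ltr_wpDl// dual_norm_ge0.
have nc : Normc.normc (c^-1)%:C = c^-1.
  apply: (@complexI R); rewrite -normcC ger0_norm// -[0]/((0 : R)%:C) lecR.
  by rewrite invr_ge0 ltW.
have f1 : `|(c^-1)%:C *: f| <= 1.
  rewrite normrZ normcC nc -[`|f|]/((dual_norm f)%:C) -rmorphM/=.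
  by rewrite -[1]/((1 : R)%:C) lecR ler_pdivrMl// mulr1 lerDl.
have d0 : 0 < n.+1%:R^-1 / c by rewrite divr_gt0// invr_gt0.
have := xI _ f1 _ d0; apply: transfer_imp1 => v.
rewrite -[((c^-1)%:C *: f) v]/((c^-1)%:C * f v) Normc.normcM nc add0r.
rewrite mulrC ltr_pM2r ?invr_gt0// subr0 normcC => h.
by rewrite -(rmorph_nat (real_complex R)) -fmorphV/= ltcR.
Qed.

Lemma infinitesimal_submod : submod_closed infinitesimal.
Proof.
split=> [|a x y /infinitesimalP x0 /infinitesimalP y0].
  by apply/infinitesimalP; rewrite weak_norm0.
apply/infinitesimalP; have := weak_norm_lin a x0 y0.
by rewrite mulr0 addr0.
Qed.

HB.instance Definition _ :=
  GRing.isSubmodClosed.Build R[i] fin_part infinitesimal infinitesimal_submod.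

Definition weak_hull : Type := {ideal_quot infinitesimal}.

HB.instance Definition _ := GRing.Zmodule.on weak_hull.

Definition hull_class (x : fin_part) : weak_hull :=
  \pi_({ideal_quot infinitesimal}) x.

Definition hull_repr (p : weak_hull) : fin_part :=
  repr (p : {ideal_quot infinitesimal}).

Lemma hull_reprK : cancel hull_repr hull_class.
Proof. exact: (@reprK _ {ideal_quot infinitesimal}). Qed.

Lemma hull_classP x y :
  hull_class x = hull_class y <-> x - y \in infinitesimal.
Proof. by rewrite Quotient.idealrBE; split=> /eqP. Qed.

Lemma hull_class_is_zmod_morphism : zmod_morphism hull_class.
Proof. exact: (raddfB (\pi_({ideal_quot infinitesimal}))). Qed.

HB.instance Definition _ := GRing.isZmodMorphism.Build fin_part weak_hull
  hull_class hull_class_is_zmod_morphism.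

Definition hull_scale (a : R[i]) (p : weak_hull) : weak_hull :=
  hull_class (a *: hull_repr p).

Lemma hull_scaleE a x : hull_scale a (hull_class x) = hull_class (a *: x).
Proof.
apply/hull_classP; rewrite -scalerBr rpredZ//.
by apply/hull_classP; rewrite hull_reprK.
Qed.

Lemma hull_scaleA a b p : hull_scale a (hull_scale b p) = hull_scale (a * b) p.
Proof. by rewrite -[p]hull_reprK !hull_scaleE scalerA. Qed.

Lemma hull_scale1 : left_id 1 hull_scale.
Proof. by move=> p; rewrite -[p]hull_reprK hull_scaleE scale1r. Qed.

Lemma hull_scaleDr : right_distributive hull_scale +%R.
Proof.
move=> a p q; rewrite -[p]hull_reprK -[q]hull_reprK -raddfD !hull_scaleE.
by rewrite -raddfD scalerDr.
Qed.

Lemma hull_scaleDl p : {morph hull_scale^~ p : a b / a + b >-> a + b}.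
Proof.
by move=> a b; rewrite -[p]hull_reprK !hull_scaleE scalerDl raddfD.
Qed.

HB.instance Definition _ := GRing.Zmodule_isLmodule.Build R[i] weak_hull
  hull_scaleA hull_scale1 hull_scaleDr hull_scaleDl.

Definition hull_norm (p : weak_hull) : R :=
  fine (weak_norm (hull_repr p : star_space)).

Lemma weak_norm_fin (x : fin_part) :
  weak_norm x = (fine (weak_norm x))%:E.
Proof.
case: x => x /= /fin_predP[q xq]; rewrite fineK//.
by rewrite ge0_fin_numE ?weak_norm_ge0// (le_lt_trans xq) ?ltry.
Qed.

Lemma weak_norm_class_le (x y : fin_part) :
  x - y \in infinitesimal -> (weak_norm x <= weak_norm y)%E.
Proof.
move=> /infinitesimalP xy.
have ylt : (weak_norm y <= (fine (weak_norm y))%:E)%E by rewrite -weak_norm_fin.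
have := weak_norm_lin 1 xy ylt.
have -> : 1 *: ((x - y : fin_part) : star_space) + (y : star_space) =
          (x : star_space).
  by rewrite scale1r; exact: (subrK (y : star_space) (x : star_space)).
by rewrite mulr0 add0r -weak_norm_fin.
Qed.

(* The norm does not depend on the representative. *)
Lemma hull_normE (x : fin_part) :
  (hull_norm (hull_class x))%:E = weak_norm x.
Proof.
rewrite /hull_norm -weak_norm_fin; apply/le_anti/andP; split;
  by apply: weak_norm_class_le; apply/hull_classP; rewrite hull_reprK.
Qed.

Lemma hull_norm_lin a p q :
  hull_norm (a *: p + q) <= Normc.normc a * hull_norm p + hull_norm q.
Proof.
rewrite -[p]hull_reprK -[q]hull_reprK.
rewrite -[a *: hull_class _]/(hull_scale a _) hull_scaleE -raddfD -lee_fin.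
by rewrite hull_normE weak_norm_lin// hull_normE.
Qed.

Lemma hull_norm0 : hull_norm 0 = 0.
Proof. by apply: EFin_inj; rewrite -(raddf0 hull_class) hull_normE weak_norm0. Qed.

Lemma hull_norm_ge0 p : 0 <= hull_norm p.
Proof. by rewrite -[p]hull_reprK -lee_fin hull_normE weak_norm_ge0. Qed.

Lemma hull_normD p q :
  (hull_norm (p + q))%:C <= (hull_norm p)%:C + (hull_norm q)%:C.
Proof.
rewrite -rmorphD/= lecR; have := hull_norm_lin 1 p q.
by rewrite scale1r Normc.normc1 mul1r.
Qed.

Lemma hull_normZ_le a p : hull_norm (a *: p) <= Normc.normc a * hull_norm p.
Proof. by have := hull_norm_lin a p 0; rewrite hull_norm0 !addr0. Qed.

Lemma hull_normZ a p : (hull_norm (a *: p))%:C = `|a| * (hull_norm p)%:C.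
Proof.
rewrite normcC -rmorphM/=; congr (_%:C); apply/le_anti.
rewrite hull_normZ_le /=.
have [->|a0] := eqVneq a 0.
  by rewrite Normc.normc0 mul0r hull_norm_ge0.
have na : 0 < Normc.normc a by rewrite -ltcR -normcC normr_gt0.
rewrite -ler_pdivlMl// -Normc.normcV.
have pE : p = a^-1 *: (a *: p) by rewrite scalerA mulVf// scale1r.
by rewrite {1}pE; exact: hull_normZ_le.
Qed.

Lemma hull_norm0_eq0 p : (hull_norm p)%:C = 0 -> p = 0.
Proof.
move=> [p0]; rewrite -[p]hull_reprK -(raddf0 hull_class); apply/hull_classP.
by rewrite subr0; apply/infinitesimalP; rewrite -hull_normE hull_reprK p0.
Qed.

HB.instance Definition _ := Lmodule_isNormed.Build R[i] weak_hull
  hull_normD hull_normZ hull_norm0_eq0.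

End WeakHull.

Definition complete_space (K : numFieldType) (V : normedModType K) : Prop :=
  forall F : set_system V, ProperFilter F -> cauchy F -> cvg F.

(* Main.v *)
Require Import Defs.
From mathcomp Require Import all_boot all_order all_algebra.
From mathcomp Require Import complex.
From mathcomp Require Import all_classical all_reals.
From mathcomp Require Import topology normedtype.
From HB Require Import structures.
From mathcomp Require Import ring lra.
Import Order.TTheory GRing.Theory Num.Theory.
Import numFieldNormedType.Exports.
Local Open Scope classical_set_scope.
Local Open Scope card_scope.
Local Open Scope ring_scope.
Local Open Scope complex_scope.

Set Implicit Arguments.
Unset Strict Implicit.

(** The isometry sends a class [p] to the functional on the dual of [X] that
    takes a form [f] to the standard part of [*f x], for any [x] in the class
    [p].  This standard part exists because a positive multiple of [f] lies in
    the unit ball of the dual, where the weak norm of [x] bounds it, and it is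
    linear in [f] and in [x].  The norm is preserved because the weak norm of
    [x] and the norm of a functional on the dual are the same supremum, over
    that unit ball ([weak_norm_le_pairing]).

    The content is surjectivity.  Given [phi] in the bidual, the internal sets
    of all [x] in [*X] with [*f x = *(phi f)], one for each form [f], have the
    finite intersection property already at standard points
    ([finite_interpolation]): any linear relation between finitely many forms
    also holds between the values of [phi], so that finitely many equations
    [f v = phi f] have a solution [v] in [X].  As there are no more of these
    sets than forms, saturation provides a common element [x]
    ([saturated_interpolation]), and [|*f x| = |phi f|] for every standard [f]
    makes the weak norm of [x] at most the norm of [phi].

    Completeness is inherited through the isometry from the bidual, which is
    complete as the dual of a normed space ([dual_complete]). *)

(** * Estimates for the complex modulus *)

Lemma gt0_complexE (R : realType) (e : R[i]) :
  0 < e -> 0 < complex.Re e /\ e = (complex.Re e)%:C.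
Proof. by case: e => a b; rewrite ltcE /= => /andP[/eqP -> ->]. Qed.

Lemma normc_small_eq0 (R : realType) (z : R[i]) :
  (forall e : R, 0 < e -> Normc.normc z <= e) -> z = 0.
Proof.
move=> ze; apply: Normc.eq0_normc; apply/le_anti; rewrite normc_ge0 andbT.
by apply/ler_addgt0Pl => e e0; rewrite addr0; exact: ze.
Qed.

Lemma normcB (R : realType) (z w : R[i]) :
  Normc.normc (z - w) = Normc.normc (w - z).
Proof. by apply: (@complexI R); rewrite -!normcC distrC. Qed.

Lemma normc_triangle (R : realType) (z w t : R[i]) :
  Normc.normc (z - t) <= Normc.normc (z - w) + Normc.normc (w - t).
Proof. by have := le_normcD (z - w) (w - t); rewrite addrA subrK. Qed.

Lemma normc_lincomb_le (R : realType) (k z w c d : R[i]) (r : R) :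
  Normc.normc (z - c) <= r -> Normc.normc (w - d) <= r ->
  Normc.normc (k * z + w - (k * c + d)) <= (Normc.normc k + 1) * r.
Proof.
move=> zr wr; have -> : k * z + w - (k * c + d) = k * (z - c) + (w - d) by ring.
rewrite (le_trans (le_normcD _ _))// mulrDl mul1r Normc.normcM lerD//.
by rewrite ler_wpM2l// normc_ge0.
Qed.

Lemma le_Re_normc (R : realType) (z : R[i]) : `|complex.Re z| <= Normc.normc z.
Proof. by case: z => a b /=; rewrite -sqrtr_sqr ler_wsqrtr// lerDl sqr_ge0. Qed.

Lemma le_Im_normc (R : realType) (z : R[i]) : `|complex.Im z| <= Normc.normc z.
Proof. by case: z => a b /=; rewrite -sqrtr_sqr ler_wsqrtr// lerDr sqr_ge0. Qed.

Lemma normc_le_ReIm (R : realType) (z : R[i]) :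
  Normc.normc z <= `|complex.Re z| + `|complex.Im z|.
Proof.
case: z => a b /=; rewrite -[leRHS]ger0_norm ?addr_ge0//.
rewrite -sqrtr_sqr ler_wsqrtr// sqrrD !real_normK ?num_real//.
by rewrite -addrA lerD2l lerDr mulrn_wge0// mulr_ge0.
Qed.

(** * Forms and the norm of the dual *)

Section Form.
Variables (R : realType) (V : normedModType R[i]).

Lemma scalarD0 (f : V -> R[i]) : scalar f -> f 0 = 0.
Proof.
by move=> fl; have := fl (-1) 0 0; rewrite scaler0 addr0 mulN1r addNr.
Qed.

Lemma scalar_normc_le (f : V -> R[i]) (q : R) : scalar f ->
  (forall v, `|v| <= 1 -> Normc.normc (f v) <= q) ->
  forall v, `|f v| <= q%:C * `|v|.
Proof.
move=> fl fq v; have f0 := scalarD0 fl.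
have [->|v0] := eqVneq v 0; first by rewrite f0 !normr0 mulr0.
have vE : v = `|v| *: (`|v|^-1 *: v).
  by rewrite scalerA mulfV ?normr_eq0// scale1r.
have -> : f v = `|v| * f (`|v|^-1 *: v).
  by rewrite {1}vE -[X in f X]addr0 fl f0 addr0.
rewrite normrM normr_id mulrC ler_wpM2r// normcC lecR; apply: fq.
by rewrite normrZ normfV normr_id mulVf ?normr_eq0.
Qed.

Definition mk_dual (f : V -> R[i]) (q : R) (fl : scalar f)
  (fq : forall v, `|v| <= 1 -> Normc.normc (f v) <= q) : dual V :=
  @Dual R V f (asboolT (conj fl (ex_intro _ q%:C (scalar_normc_le fl fq)))).

Lemma normc_dual_le (f : dual V) v :
  Normc.normc (f v) <= dual_norm f * Normc.normc (`|v| : R[i]).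
Proof.
have [fl _] := dualP f.
rewrite -lecR rmorphM/= -!normcC normr_id.
exact: (scalar_normc_le fl (fun v => @dual_norm_ub R V f v)).
Qed.
End Form.

(** * Finite interpolation *)

Section Interpolation.
Variables (R : realType) (V : normedModType R[i]).

(** On the common kernel of [gs] a form [f] vanishes only if it is a linear
    combination of [gs], so that [phi f] is determined by the values of [phi] on
    [gs].  The induction eliminates one form of [gs] at a time and never writes
    the combination down. *)
Lemma eval_determined (phi : dual V -> R[i]) (gs : seq (dual V)) (x0 : V)
    (f : dual V) :
  scalar phi -> (forall g, g \in gs -> g x0 = phi g) ->
  (forall v : V, (forall g, g \in gs -> g v = 0) -> f v = 0) ->
  f x0 = phi f.
Proof.
move=> phil; elim: gs f => [|g gs IH] f gx0 fv.
  have -> : f = 0 by apply/val_inj/funext => v /=; exact: fv.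
  by rewrite (scalarD0 phil).
have {}IH h := IH h (fun k kgs => gx0 k (mem_behead (s := _ :: _) kgs)).
have [[y [ygs gy]]|gv] :=
  pselect (exists y : V, (forall k, k \in gs -> k y = 0) /\ g y <> 0).
  have {}gy : g y != 0 by apply/eqP.
  (* [h] is chosen to vanish at [y], hence on the whole kernel of [gs], which
     is the kernel of [g :: gs] plus the line of [y]. *)
  set h := - (f y / g y) *: g + f.
  have hE v : h v = - (f y / g y) * g v + f v by [].
  have := IH h; rewrite phil hE (gx0 g) ?mem_head// => /(_ _)/addrI; apply.
  move=> v vgs; rewrite hE.
  have := fv (- (g v / g y) *: y + v); rewrite dualE => H.
  have -> : - (f y / g y) * g v + f v = - (g v / g y) * f y + f v by ring.
  apply: H => k; rewrite inE => /orP[/eqP->|kgs]; rewrite dualE.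
    by rewrite mulNr divfK// addNr.
  by rewrite (ygs k)// (vgs k)// mulr0 addr0.
apply: IH => v vgs; apply: fv => k; rewrite inE.
case/orP => [/eqP->|]; last exact: vgs.
by apply: contrapT => gv0; apply: gv; exists v.
Qed.

(** Each new form [g] is either nonzero somewhere on the common kernel of the
    previous ones, and the solution is corrected there, or its value is already
    determined.  The agreement is exact and the norm of the vector is not
    controlled: the weak norm sees an element of [*X] only through the standard
    forms. *)
Lemma finite_interpolation (phi : dual V -> R[i]) (gs : seq (dual V)) :
  scalar phi -> exists v : V, forall g, g \in gs -> g v = phi g.
Proof.
move=> phil; elim: gs => [|g gs [x0 x0gs]]; first by exists 0.
have [[y [ygs gy]]|gv] :=
  pselect (exists y : V, (forall k, k \in gs -> k y = 0) /\ g y <> 0).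
  exists (((phi g - g x0) / g y) *: y + x0) => k.
  rewrite inE => /orP[/eqP->|kgs]; rewrite dualE.
    by rewrite divfK ?subrK//; apply/eqP.
  by rewrite (ygs k)// mulr0 add0r x0gs.
exists x0 => k; rewrite inE => /orP[/eqP->|]; last exact: x0gs.
apply: (eval_determined phil x0gs) => v vgs.
by apply: contrapT => gv0; apply: gv; exists v.
Qed.

End Interpolation.

(** * Completeness *)

(** The limit is taken along a filter on an arbitrary type, so that it applies
    to the evaluations of a filter of forms at a fixed vector. *)
Lemma real_cauchy_filter (R : realType) (T : Type) (F : set_system T)
    (u : T -> R) : ProperFilter F ->
  (forall e : R, 0 < e -> exists s, \forall t \near F, `|u s - u t| <= e) ->
  exists l, forall e : R, 0 < e -> \forall t \near F, `|u t - l| <= e.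
Proof.
move=> FF uc.
have /cauchy_cvgP/cvg_ex[l ul] : cauchy (u @ F).
  apply: cauchy_exP => e e0.
  have [|s sF] := uc (e / 2); first by rewrite divr_gt0.
  exists (u s); apply: (@filterS _ F _ _ _ _ sF) => t /= h.
  rewrite -ball_normE /ball_ /=.
  by rewrite (le_lt_trans h)// ltr_pdivrMr// ltr_pMr// ltr1n.
exists l => e e0; move/cvgrPdist_le: ul => /(_ _ e0); apply: filterS => t.
by rewrite distrC.
Qed.

Lemma complex_cauchy_filter (R : realType) (T : Type) (F : set_system T)
    (u : T -> R[i]) : ProperFilter F ->
  (forall e : R, 0 < e ->
     exists s, \forall t \near F, Normc.normc (u s - u t) <= e) ->
  exists l, forall e : R, 0 < e ->
     \forall t \near F, Normc.normc (u t - l) <= e.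
Proof.
move=> FF uc.
have [|a ua] := @real_cauchy_filter R T F (fun t => complex.Re (u t)) FF.
  move=> e e0; have [s sF] := uc _ e0; exists s; apply: filterS sF => t.
  by apply: le_trans; rewrite -raddfB; exact: le_Re_normc.
have [|b ub] := @real_cauchy_filter R T F (fun t => complex.Im (u t)) FF.
  move=> e e0; have [s sF] := uc _ e0; exists s; apply: filterS sF => t.
  by apply: le_trans; rewrite -raddfB; exact: le_Im_normc.
exists (a +i* b) => e e0; have e2 : 0 < e / 2 by rewrite divr_gt0.
apply: filterS2 (ua _ e2) (ub _ e2) => t ta tb.
rewrite (le_trans (normc_le_ReIm _))// [leRHS]splitr !raddfB/=.
exact: lerD.
Qed.

(** A Cauchy filter of forms converges pointwise.  The Cauchy estimate being
    uniform on the unit ball, it passes to the pointwise limit, which is thus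
    bounded and the limit in norm. *)
Lemma dual_complete (R : realType) (V : normedModType R[i]) :
  complete_space (dual V).
Proof.
move=> F FF /cauchyP Fc.
have {}Fc (e : R) : 0 < e ->
    exists g, \forall f \near F, dual_norm (g - f : dual V) <= e.
  move=> e0; have [|g gF] := Fc e%:C; first by rewrite ltcR.
  exists g; apply: filterS gF => f; rewrite -ball_normE /ball_ /=.
  by rewrite -[`|g - f|]/((dual_norm (g - f : dual V))%:C) ltcR => /ltW.
have /choice[L LF] w : exists l, forall e : R, 0 < e ->
    \forall f \near F, Normc.normc ((f : dual V) w - l) <= e.
  apply: complex_cauchy_filter => e e0.
  have w1 : 0 < Normc.normc (`|w| : R[i]) + 1 by rewrite ltr_wpDl// normc_ge0.
  have [|g gF] := Fc (e / (Normc.normc (`|w| : R[i]) + 1)).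
    by rewrite divr_gt0.
  exists g; apply: filterS gF => f gf.
  have := normc_dual_le (g - f) w; rewrite -[(g - f) w]/(g w - f w) => h.
  apply: (le_trans h); apply: (le_trans (ler_wpM2r (normc_ge0 _) gf)).
  by rewrite -mulrA ger_pMr// ler_pdivrMl// mulr1 lerDl.
have Ll : scalar L.
  move=> a v w; apply/eqP; rewrite -subr_eq0.
  apply/eqP/normc_small_eq0 => e e0.
  have m0 : 0 < Normc.normc a + 1 by rewrite ltr_wpDl// normc_ge0.
  have e2 : 0 < e / 2 by rewrite divr_gt0.
  have d0 : 0 < e / 2 / (Normc.normc a + 1) by rewrite divr_gt0.
  have [f [[h1 h2] h3]] := filter_ex
    (filterI (filterI (LF (a *: v + w) _ e2) (LF v _ d0)) (LF w _ d0)).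
  move: h1; rewrite /= dualE => h1.
  rewrite (le_trans (normc_triangle _ (a * f v + f w) _))// normcB.
  rewrite [leRHS]splitr; apply: lerD => //.
  apply: (le_trans (normc_lincomb_le a h2 h3)).
  by rewrite mulrC divfK// gt_eqF.
have close (g : dual V) (r : R) :
    (\forall f \near F, dual_norm (g - f : dual V) <= r) ->
    forall w, `|w| <= 1 -> Normc.normc (g w - L w) <= r.
  move=> gr w w1; apply/ler_addgt0Pl => e e0.
  have [f [h1 h2]] := filter_ex (filterI gr (LF w _ e0)).
  rewrite (le_trans (normc_triangle _ (f w) _))// addrC lerD//.
  exact: le_trans (@dual_norm_ub R V (g - f) w w1) h1.
have [g0 g0F] := Fc 1 ltr01.
have Lb w : `|w| <= 1 -> Normc.normc (L w) <= 1 + dual_norm g0.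
  move=> w1; have h1 := dual_norm_ub g0 w1; have := close _ _ g0F w w1.
  have := normc_triangle (L w) (g0 w) 0; rewrite !subr0 normcB.
  by lra.
apply/cvg_ex; exists (mk_dual Ll Lb).
apply/fcvgrPdist_lt => e /gt0_complexE[r0 ->].
have [|g gF] := Fc (complex.Re e / 3); first by rewrite divr_gt0.
apply: filterS (gF) => f gf.
rewrite -[`|_ - f|]/((dual_norm (mk_dual Ll Lb - f : dual V))%:C) ltcR.
apply: (@le_lt_trans _ _ (complex.Re e / 3 + complex.Re e / 3)); last by lra.
apply: dual_norm_le => w w1; rewrite -[(_ - f) w]/(L w - f w).
rewrite (le_trans (normc_triangle _ (g w) _))// lerD//.
  by rewrite normcB; exact: close.
exact: le_trans (@dual_norm_ub R V (g - f) w w1) gf.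
Qed.

Lemma complete_isometry (K : numFieldType) (V W : normedModType K)
    (T : {linear V -> W}) :
  bijective T -> (forall v, `|T v| = `|v|) ->
  complete_space W -> complete_space V.
Proof.
move=> [S TK SK] Tn Wc F FF /cauchyP Fc.
have dist v w : `|T v - T w| = `|v - w| by rewrite -raddfB Tn.
have /cvg_ex[l Fl] : cvg (T @ F).
  apply: Wc; apply: cauchy_exP => e e0; have [v vF] := Fc _ e0; exists (T v).
  apply: (@filterS _ F _ _ _ _ vF) => w; rewrite -!ball_normE /ball_ /= => vw.
  by rewrite dist.
apply/cvg_ex; exists (S l); apply/fcvgrPdist_lt => e e0.
move/fcvgrPdist_lt: Fl => /(_ _ e0) Fl.
have {}Fl : F [set w | `|l - T w| < e] by exact: Fl.
apply: (filterS _ Fl) => w /=.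
by rewrite /= -(dist (S l)) SK.
Qed.

(** * Standard parts of complex-valued functions *)

(** The solution set of [*u x = *b] is internal. *)
Lemma holds_eq_std (N : nonstandard_extension) (A B : Type) (u : A -> B) (b : B)
    (x : dom N A) :
  holds (ap (std N (fun a => u a = b)) x) <-> lift1 u x = std N b.
Proof.
pose uT : term [:: A] B := App (Cst u) (Var V0).
pose hT : term [:: A] Prop := App (Cst (fun a => u a = b)) (Var V0).
have /= := (transfer N (FAll (FAnd (FImp (FEq hT (Cst True)) (FEq uT (Cst b)))
  (FImp (FEq uT (Cst b)) (FEq hT (Cst True)))))).1.
move=> /(_ _ x)[a|hu uh]; last by split; [exact: hu|exact: uh].
by split=> [->//|ua]; exact: eq_TrueI.
Qed.

Section StandardPart.
Variables (N : nonstandard_extension) (R : realType).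

(** The relation between [*u x] and [c], not between [x] and [c]; the radii are
    all the positive reals, as in [weak_norm_le]. *)
Definition infinitely_close (A : Type) (u : A -> R[i]) (x : dom N A) (c : R[i])
    : Prop :=
  forall e : R, 0 < e ->
    holds (lift1 (fun a => (Normc.normc (u a - c) < e : Prop)) x).

Lemma infinitely_close_uniq (A : Type) (u : A -> R[i]) (x : dom N A) c d :
  infinitely_close u x c -> infinitely_close u x d -> c = d.
Proof.
move=> uc ud; apply/eqP; rewrite -subr_eq0; apply/eqP/normc_small_eq0 => e e0.
have e2 : 0 < e / 2 by rewrite divr_gt0.
rewrite leNgt; apply/negP => cd.
apply: (transfer_absurd _ (uc _ e2) (ud _ e2)).
move=> a h1 h2; move: cd; apply/negP; rewrite -leNgt.
rewrite (le_trans (normc_triangle _ (u a) _))// normcB [leRHS]splitr.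
by rewrite lerD// ltW.
Qed.

(** The real and the imaginary part of a finite complex number are finite, hence
    have standard parts. *)
Lemma infinitely_close_exists (A : Type) (u : A -> R[i]) (x : dom N A) (q : R) :
  holds (lift1 (fun a => (Normc.normc (u a) < q : Prop)) x) ->
  exists c, infinitely_close u x c.
Proof.
move=> uq.
have part (p : R[i] -> R) : (forall z, `|p z| <= Normc.normc z) ->
    exists s : R, forall n,
      holds (lift1 (fun a => (`|p (u a) - s| < n.+1%:R^-1 : Prop)) x).
  move=> pn; have [|s xs] := @st_exists N R A (p \o u) x.
    exists (Num.truncn q).+1; rewrite lift1_comp ns_lt_stdr.
    apply: transfer_imp1 uq => a /= ua.
    by rewrite (le_lt_trans (pn _))// (lt_trans ua)// truncnS_gt.
  by exists s; apply/ns_approx_stdr.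
have [s us] := part _ (@le_Re_normc R).
have [t ut] := part _ (@le_Im_normc R).
exists (s +i* t) => e e0.
have [|n ne] := @small_inv R (e / 2); first by rewrite divr_gt0.
apply: transfer_imp2 (us n) (ut n) => a h1 h2.
rewrite (le_lt_trans (normc_le_ReIm _))// [ltRHS]splitr !raddfB/=.
by rewrite ltrD// (lt_trans _ ne).
Qed.

Lemma infinitely_close_lincomb_point (A B C : Type) (u : A -> R[i])
    (v : B -> R[i]) (w : C -> R[i]) (g : A -> B -> C) (k : R[i])
    (x : dom N A) (y : dom N B) c d :
  (forall a b, w (g a b) = k * u a + v b) ->
  infinitely_close u x c -> infinitely_close v y d ->
  infinitely_close w (lift2 g x y) (k * c + d).
Proof.
move=> wE uc vd e e0.
have m0 : 0 < Normc.normc k + 1 by rewrite ltr_wpDl// normc_ge0.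
have d0 : 0 < e / 2 / (Normc.normc k + 1) by rewrite !divr_gt0.
rewrite lift1_lift2; apply: transfer_imp11 (uc _ d0) (vd _ d0) => a b h1 h2.
rewrite wE (le_lt_trans (normc_lincomb_le k (ltW h1) (ltW h2)))//.
by rewrite mulrC divfK ?gt_eqF// ltr_pdivrMr// ltr_pMr// ltr1n.
Qed.

Lemma infinitely_close_lincomb_form (A : Type) (u v : A -> R[i]) (k : R[i])
    (x : dom N A) c d :
  infinitely_close u x c -> infinitely_close v x d ->
  infinitely_close (fun a => k * u a + v a) x (k * c + d).
Proof.
move=> uc vd e e0.
have m0 : 0 < Normc.normc k + 1 by rewrite ltr_wpDl// normc_ge0.
have d0 : 0 < e / 2 / (Normc.normc k + 1) by rewrite !divr_gt0.
apply: transfer_imp2 (uc _ d0) (vd _ d0) => a h1 h2.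
rewrite (le_lt_trans (normc_lincomb_le k (ltW h1) (ltW h2)))//.
by rewrite mulrC divfK ?gt_eqF// ltr_pdivrMr// ltr_pMr// ltr1n.
Qed.
End StandardPart.

(** * The isometry with the bidual *)

Section Pairing.
Variables (N : nonstandard_extension) (R : realType) (X : normedModType R[i]).
Implicit Types (f g : dual X) (x y : star_space N X).

(** The weak norm bounds only the forms of the unit ball, so that [f] is
    rescaled into it. *)
Lemma fin_close_exists (x : fin_part N X) f :
  exists c, infinitely_close f (x : star_space N X) c.
Proof.
have /fin_predP[q /weak_norm_le xq] : fin_val x \in @fin_pred N R X by case: x.
have n0 : 0 < dual_norm f + 1 by rewrite ltr_wpDl// dual_norm_ge0.
(* The summand [1] covers the case [f = 0]. *)
set m := (dual_norm f + 1)^-1; have m0 : 0 < m by rewrite invr_gt0.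
have mn : Normc.normc m%:C = m.
  by apply: (@complexI R); rewrite -normcC ger0_norm// lecR ltW.
have mf1 : `|m%:C *: f| <= 1.
  rewrite normrZ normcC mn -[`|f|]/((dual_norm f)%:C) -rmorphM/=.
  by rewrite -[1]/((1 : R)%:C) lecR ler_pdivrMl// mulr1 lerDl.
apply: (@infinitely_close_exists N R _ _ _ ((q + 1) / m)).
apply: transfer_imp1 (xq _ mf1 1 ltr01) => v.
by rewrite -[(m%:C *: f) v]/(m%:C * f v) Normc.normcM mn ltr_pdivlMr// mulrC.
Qed.

Definition pairing (p : weak_hull N X) f : R[i] :=
  xget 0 [set c | infinitely_close f (hull_repr p : star_space N X) c].

Lemma infinitesimal_close (x : fin_part N X) f :
  x \in @infinitesimal N R X -> infinitely_close f (x : star_space N X) 0.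
Proof.
move=> /asboolP/(_ f)/ns_approx_stdr xI e e0.
have [n ne] := small_inv e0; apply: transfer_imp1 (xI n) => v.
rewrite normcC => h; apply: lt_trans ne.
by rewrite -ltcR fmorphV rmorph_nat.
Qed.

Lemma star_linE a x y : a *: x + y = lift2 (fun u v : X => a *: u + v)
  (x : dom N X) (y : dom N X).
Proof.
transitivity (lift2 +%R (lift1 (fun v : X => a *: v) (x : dom N X))
                        (lift1 id (y : dom N X))).
  by rewrite lift1_id.
by rewrite lift2_lift1.
Qed.

Lemma close_lin f a x y c d :
  infinitely_close f x c -> infinitely_close f y d ->
  infinitely_close f (a *: x + y) (a * c + d).
Proof.
move=> xc yd; rewrite star_linE.
apply: infinitely_close_lincomb_point xc yd => u v.
exact: dualE.
Qed.

Lemma close_class (x y : fin_part N X) f c : hull_class x = hull_class y ->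
  infinitely_close f (x : star_space N X) c ->
  infinitely_close f (y : star_space N X) c.
Proof.
move=> /esym/hull_classP/(infinitesimal_close f) xy0 xc.
have := close_lin 1 xy0 xc; rewrite mulr0 add0r scale1r.
by have -> : ((y - x : fin_part N X) : star_space N X) + (x : star_space N X) =
  (y : star_space N X) by exact: (subrK (x : star_space N X)).
Qed.

Lemma pairing_close (x : fin_part N X) f :
  infinitely_close f (x : star_space N X) (pairing (hull_class x) f).
Proof.
apply: (@close_class (hull_repr (hull_class x))); first exact: hull_reprK.
rewrite /pairing; case: xgetP => [c _ //|].
by have [c xc] := fin_close_exists (hull_repr (hull_class x)) f => /(_ c).
Qed.

Lemma pairingE (x : fin_part N X) f c :
  infinitely_close f (x : star_space N X) c -> pairing (hull_class x) f = c.
Proof. by move=> xc; exact: infinitely_close_uniq (pairing_close x f) xc. Qed.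

Lemma pairing_linl a p q f :
  pairing (a *: p + q) f = a * pairing p f + pairing q f.
Proof.
rewrite -[p]hull_reprK -[q]hull_reprK.
rewrite -[a *: hull_class _]/(hull_scale a _) hull_scaleE -raddfD.
apply: pairingE; apply: close_lin; exact: pairing_close.
Qed.

Lemma pairing_linr p : scalar (pairing p).
Proof.
move=> a f g; rewrite -[p]hull_reprK; apply: pairingE.
by apply: infinitely_close_lincomb_form; exact: pairing_close.
Qed.

(** The standard part of [|*f x|] is the modulus of the standard part of
    [*f x], so that the weak norm is the norm of a functional on the dual. *)
Lemma weak_norm_le_pairing (x : fin_part N X) (q : R) :
  (weak_norm (x : star_space N X) <= q%:E)%E <->
  forall f, `|f| <= 1 -> Normc.normc (pairing (hull_class x) f) <= q.
Proof.
split=> [/weak_norm_le xq f f1|xq].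
  rewrite leNgt; apply/negP => qp.
  set c := pairing _ _ in qp.
  (* Half of the excess: [|*f x|] would be both below and above the midpoint
     of [q] and [|c|]. *)
  have e0 : 0 < (Normc.normc c - q) / 2 by rewrite divr_gt0// subr_gt0.
  apply: (transfer_absurd _ (xq f f1 _ e0) (pairing_close x f e0)) => v h1 h2.
  have := normc_triangle c (f v) 0; rewrite !subr0 normcB -/c in h2 *.
  by lra.
apply/weak_norm_le => f f1 e e0.
apply: transfer_imp1 (pairing_close x f e0) => v h1.
have := normc_triangle (f v) (pairing (hull_class x) f) 0; rewrite !subr0.
by have := xq f f1; lra.
Qed.

Lemma pairing_le (p : weak_hull N X) f : `|f| <= 1 ->
  Normc.normc (pairing p f) <= hull_norm p.
Proof.
have := (weak_norm_le_pairing (hull_repr p) (hull_norm p)).1.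
by rewrite hull_reprK; apply; rewrite weak_norm_fin.
Qed.

Definition to_bidual (p : weak_hull N X) : dual (dual X) :=
  mk_dual (pairing_linr p) (pairing_le p).

Lemma to_bidual_linear : linear to_bidual.
Proof.
by move=> a p q; apply/val_inj/funext => f /=; exact: pairing_linl.
Qed.

HB.instance Definition _ := GRing.isLinear.Build R[i] (weak_hull N X)
  (dual (dual X)) _ to_bidual to_bidual_linear.

Lemma to_bidual_norm p : `|to_bidual p| = `|p|.
Proof.
rewrite -[LHS]/((dual_norm (to_bidual p))%:C) -[RHS]/((hull_norm p)%:C).
congr (_%:C); apply/le_anti/andP; split.
  by apply: dual_norm_le => f; exact: pairing_le.
rewrite -{1}[p]hull_reprK -lee_fin hull_normE.
apply/weak_norm_le_pairing => f f1; rewrite hull_reprK.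
exact: (@dual_norm_ub R (dual X) (to_bidual p) f f1).
Qed.

(** Equations, in place of approximations with an error [1/n], keep the family
    indexed by the forms alone, hence no larger than the dual. *)
Lemma saturated_interpolation (K : Type) (phi : dual X -> R[i]) :
  saturated N K -> [set: dual X] #<= [set: K] -> scalar phi ->
  exists x : dom N X, forall f, lift1 (f : X -> R[i]) x = std N (phi f).
Proof.
move=> satN XK phil.
pose S f := [set x : dom N X | lift1 (f : X -> R[i]) x = std N (phi f)].
have [] := @satN X (range S).
- move=> _ [f _ <-]; exists (std N (fun v : X => f v = phi f :> R[i])).
  by apply/seteqP; split=> x /holds_eq_std.
- exact: card_le_trans (card_image_le _ _) XK.
- move=> G Gfin GS.
  have /choice[sel selP] : forall A : set (dom N X), exists f, G A -> S f = A.
    move=> A; have [GA|nGA] := pselect (G A); last by exists 0.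
    by have [f _ fA] := GS A GA; exists f.
  have /finite_seqP[gs gsE] := finite_image sel Gfin.
  have [v vgs] := finite_interpolation gs phil.
  exists (std N v) => A GA; rewrite -(selP A GA) /S /= lift1_std vgs//.
  by have : (sel @` G) (sel A) by [exists A]; rewrite gsE.
by move=> x xS; exists x => f; apply: (xS (S f)); exists f.
Qed.

(** A common solution [x] of the equations [*f x = *(phi f)] has finite weak
    norm because [|phi f|] is at most the norm of [phi] on the unit ball. *)
Lemma to_bidual_surj (K : Type) (phi : dual (dual X)) :
  saturated N K -> [set: dual X] #<= [set: K] ->
  exists p, to_bidual p = phi.
Proof.
move=> satN XK; have [phil _] := dualP phi.
have [x xphi] := saturated_interpolation satN XK phil.
have xc f : infinitely_close f x (phi f).
  move=> e e0.
  rewrite -[lift1 _ _](lift1_comp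
    (fun z => Normc.normc (z - phi f) < e : Prop) f).
  rewrite xphi lift1_std; congr std; apply: propT.
  by rewrite subrr Normc.normc0.
have xfin : (x : star_space N X) \in @fin_pred N R X.
  apply/fin_predP; exists (dual_norm phi); apply/weak_norm_le => f f1 e e0.
  apply: transfer_imp1 (xc f e e0) => v h.
  have := normc_triangle (f v) (phi f) 0; rewrite !subr0.
  by have := dual_norm_ub phi f1; lra.
exists (hull_class (FinPart xfin)); apply/val_inj/funext => f.
exact: pairingE.
Qed.
End Pairing.

Theorem theorem2 (R : realType) (X : normedModType R[i])
    (kappa : Type) (N : nonstandard_extension)
    (kappa_uncountable : ~ countable [set: kappa])
    (dual_le_kappa : [set: dual X] #<= [set: kappa])
    (dual_lt_kappa : ~ ([set: kappa] #<= [set: dual X]))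
    (N_saturated : saturated N kappa) :
  complete_space (weak_hull N X) /\
  exists T : {linear weak_hull N X -> dual (dual X)},
    bijective T /\ forall p : weak_hull N X, `|T p| = `|p|.
Proof.
have Tn (p : weak_hull N X) : `|to_bidual p| = `|p| by exact: to_bidual_norm.
have Tbij : bijective (@to_bidual N R X).
  rewrite -setTT_bijective; split=> // [p q _ _ pq|phi _].
    by apply/eqP; rewrite -subr_eq0 -normr_eq0 -Tn raddfB/= pq subrr normr0.
  have [p pphi] := to_bidual_surj phi N_saturated dual_le_kappa.
  by exists p.
split; first exact: complete_isometry Tbij Tn (@dual_complete R (dual X)).
by exists (@to_bidual N R X).
Qed.
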